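(* The class $\mathcal{P}_1$ of partial automorphisms of finite ordered posets has the cofinal amalgamation property (CAP).
   Context: An ordered poset is a structure $(P,\prec,<)$ where $(P,\prec)$ is a finite partial order and $<$ is a linear order on $P$ extending $\prec$; $\mathcal{P}$ is the class of finite ordered posets. $\mathcal{P}_1$ is the class of pairs $(A,p)$ with $A\in\mathcal{P}$ and $p$ a partial automorphism of $A$ (an isomorphism between substructures of $A$); an embedding $(A,p)\to(B,q)$ is an embedding $\phi\colon A\to B$ with $\phi\circ p=q\circ\phi$. CAP means: for every $(A_0,p_0)\in\mathcal{P}_1$ there is $(A,p)\in\mathcal{P}_1$ extending it such that any two $(B,q),(C,r)\in\mathcal{P}_1$ extending $(A,p)$ have an amalgam $(D,s)\in\mathcal{P}_1$ over $(A,p)$ (i.e., embeddings of $(B,q)$ and $(C,r)$ into $(D,s)$ agreeing on $A$). *)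

(* Defs.v *)
From HB Require Import structures.
From mathcomp Require Import all_boot.

Set Implicit Arguments.
Unset Strict Implicit.
Unset Printing Implicit Defensive.

(* Both orders are given by their strict relations. *)
Record ordered_poset := OrderedPoset {
  carrier :> finType;
  prec : rel carrier;
  lt : rel carrier;
  prec_irr : irreflexive prec;
  prec_trans : transitive prec;
  lt_irr : irreflexive lt;
  lt_trans : transitive lt;
  lt_total : forall x y : carrier, [|| lt x y, x == y | lt y x];
  lt_prec : subrel prec lt
}.

Definition op_embedding (A B : ordered_poset) (f : A -> B) : Prop :=
  [/\ injective f,
      forall x y, prec (f x) (f y) = prec x y &
      forall x y, lt (f x) (f y) = lt x y].

(* [p x = Some y] means that [p] is defined at [x] with value [y]; the two
   substructures are the domain and the range of [p]. *)
Definition is_partial_aut (A : ordered_poset) (p : A -> option A) : Prop :=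
  [/\ forall x y z, p x = Some z -> p y = Some z -> x = y,
      forall x y x' y', p x = Some x' -> p y = Some y' -> prec x' y' = prec x y &
      forall x y x' y', p x = Some x' -> p y = Some y' -> lt x' y' = lt x y].

Record P1 := MkP1 {
  base :> ordered_poset;
  paut : base -> option base;
  pautP : is_partial_aut paut
}.

(* The equation f o p = q o f is required on the domain of p only: q may be
   defined at points of f(A) outside f(dom p), so that for an inclusion f it
   says that the graph of q contains that of p. *)
Definition P1_embedding (A B : P1) (f : A -> B) : Prop :=
  op_embedding f /\ forall x y, paut x = Some y -> paut (f x) = Some (f y).

(* [K] is a class of structures with underlying sets [El]; an extension of a
   structure is an embedding of it into another one. *)
Definition CAP (K : Type) (El : K -> Type)
    (emb : forall A B : K, (El A -> El B) -> Prop) : Prop :=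
  forall A0 : K, exists (A : K) (i : El A0 -> El A),
    emb A0 A i /\
    forall (B C : K) (f : El A -> El B) (g : El A -> El C),
      emb A B f -> emb A C g ->
      exists (D : K) (h : El B -> El D) (k : El C -> El D),
        [/\ emb B D h, emb C D k & forall a : El A, h (f a) = k (g a)].

(* Main.v *)
Require Import Defs.
From HB Require Import structures.
From mathcomp Require Import all_boot.
From mathcomp Require Import order ssralg ssrnum ssrint intdiv zify.
From mathcomp Require Import boolp classical_sets.

(** A finite partial automorphism generates infinite structures with a total
    automorphism sigma, and these amalgamate freely over a common sigma-invariant
    substructure, with Zorn's lemma providing an invariant linear order.  Hence
    (A, p) is an amalgamation base as soon as it determines, for all x, y in A
    and all n, whether x <= sigma^n y, for both orders, in every extension.

    To reach such an A from A0: in the free extension of A0 the relations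
    "x <= sigma^n y" between x, y in A0 are periodic in n far from 0, of period
    K say.  If such a relation holds far out in a residue class mod K, it factors
    through some w in A0 with w <= sigma^(sK) w, s = 1 or -1, so it is forced by
    finitely many data.  If it fails, this too is forced by finitely many data
    after adding a least upper bound v of the sigma^(s m K) y, m >= 1.  These
    new elements satisfy sigma^(sK) v <= v, so every relation with such a v is
    monotone along residue classes mod K, and so are those of the linear order.
    A monotone sequence is determined by a finite window once that window shows
    each of the truth values taken in any extension; as only finitely many such
    facts can occur, it suffices to maximise their number. *)

Set Implicit Arguments.
Unset Strict Implicit.
Unset Printing Implicit Defensive.

Import Order.TTheory GRing.Theory Num.Theory.
Local Open Scope ring_scope.

(** * Invariant orders on G * Z *)

(* [R b x y n] reads [x <= sigma^n y], where [sigma] is the automorphism of the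
   structure on [G * Z] generated by [G]; [b = true] stands for the weak form of
   [prec] and [b = false] for that of [lt]. Elements related both ways are
   identified, so [G * Z] need not be replaced by a quotient. *)
Definition zrelation (G : Type) := bool -> G -> G -> int -> Prop.

(* [zaper] excludes nontrivial finite orbits, which no invariant linear order
   admits. *)
Record is_zorder (G : Type) (R : zrelation G) : Prop := {
  zrefl : forall b x, R b x x 0;
  ztrans : forall b y x z m n k,
    R b x y m -> R b y z n -> k = m + n -> R b x z k;
  zsub : forall x y n, R true x y n -> R false x y n;
  zanti : forall x y n, R false x y n -> R false y x (- n) -> R true x y n;
  zaper : forall x n, 0 < n -> R false x x n -> R false x x (- n) ->
    R false x x 1 \/ R false x x (- 1) }.

Definition ztotal (G : Type) (R : zrelation G) : Prop :=
  forall x y n, R false x y n \/ R false y x (- n).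

Definition sg (s : bool) : int := if s then 1 else - 1.

Lemma ziter (G : Type) (R : zrelation G) b x (d : int) (k : nat) :
  is_zorder R -> R b x x d -> R b x x (d * k%:Z).
Proof.
move=> zR Rd; elim: k => [|k IHk]; first by rewrite mulr0; apply: zrefl.
by apply: (ztrans zR Rd IHk); lia.
Qed.

Section Linearize.

Variables (G : Type) (R : zrelation G).
Hypothesis zR : is_zorder R.

(* The preorders [L] that can replace [R false]: they create no new
   equivalences. *)
Definition zextension (L : G -> G -> int -> Prop) : Prop :=
  [/\ forall x y n, R false x y n -> L x y n,
      forall y x z m n k, L x y m -> L y z n -> k = m + n -> L x z k &
      forall x y n, L x y n -> L y x (- n) -> R true x y n].

Let triple (L : G -> G -> int -> Prop) : set (G * G * int) :=
  [set t | L t.1.1 t.1.2 t.2]%classic.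
(** Building in [R false] makes the union of the empty chain an extension, as Zorn's lemma
    demands. *)
Let untriple (A : set (G * G * int)) x y n :=
  R false x y n \/ A (x, y, n).

Lemma zextension_maximal : exists L, zextension L /\
  forall L', zextension L' -> (forall x y n, L x y n -> L' x y n) ->
    forall x y n, L' x y n -> L x y n.
Proof.
have [|A [PA maxA]] := @Zorn_bigcup _ (fun A => zextension (untriple A)).
  move=> F FP totF.
  (* The conditions on an extension have at most two premises about [L], and two such premises hold
     together in one member of the chain or in [R false]. *)
  have common t t' : untriple (\bigcup_(X in F) X) t.1.1 t.1.2 t.2 ->
      untriple (\bigcup_(X in F) X) t'.1.1 t'.1.2 t'.2 ->
      exists2 L, zextension L &
        [/\ L t.1.1 t.1.2 t.2, L t'.1.1 t'.1.2 t'.2 &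
            forall x y n, L x y n -> untriple (\bigcup_(X in F) X) x y n].
    have ext X : F X -> forall x y n, untriple X x y n ->
        untriple (\bigcup_(X in F) X) x y n.
      by move=> FX x y n [|Xt]; [left | right; exists X].
    case: t t' => [[x y] n] [[x' y'] n'] /= [Rt|[X FX Xt]] [Rt'|[X' FX' Xt']].
    - exists (R false); last by split=> // *; left.
      by split=> //; [apply: ztrans | apply: zanti].
    - by exists (untriple X'); [apply: FP | split; [left|right|apply: ext]].
    - by exists (untriple X); [apply: FP | split; [right|left|apply: ext]].
    - have [XX'|X'X] := totF _ _ FX FX'.
        exists (untriple X'); first exact: FP.
        by split; [right; apply: XX'|right|apply: ext].
      exists (untriple X); first exact: FP.
      by split; [right|right; apply: X'X|apply: ext].
  split; first by left.
    move=> y x z m n k xy yz ->.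
    have [L [LR Ltr La] [/= Lxy Lyz LF]] := common (x, y, m) (y, z, n) xy yz.
    by apply: LF; apply: (Ltr _ _ _ _ _ _ Lxy Lyz).
  move=> x y n xy yx.
  have [L [LR Ltr La] [/= Lxy Lyx LF]] := common (x, y, n) (y, x, - n) xy yx.
  exact: La.
exists (untriple A); split=> // L' PL' AL' x y n L'xyn.
apply: contrapT => nA; apply: (maxA (triple L')).
  split; first by move=> [[x' y'] n'] At; apply: AL'; right.
  by move=> L'A; apply: nA; right; apply: (L'A (x, y, n)).
suff -> : untriple (triple L') = L' by [].
apply/funext => x'; apply/funext => y'; apply/funext => n'; apply/propext.
by split=> [[Rt|//]|]; [case: PL' => LR _ _; apply: LR | right].
Qed.

(** Were [x] unrelated to both its neighbours [sigma x] and [sigma^-1 x], the exponents [n] with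
    [L x x n] could not take both signs, so the orbit of [x] could still be directed one way,
    against maximality. *)
Lemma zextension_orbit L x : zextension L ->
  (forall L', zextension L' -> (forall x y n, L x y n -> L' x y n) ->
    forall x y n, L' x y n -> L x y n) ->
  exists s, L x x (sg s).
Proof.
move=> [LR Ltr La] maxL; apply: contrapT => noL.
have L0 u : L u u 0 by apply: LR; apply: zrefl.
have Lit (d : int) (k : nat) : L x x d -> L x x (d * k%:Z).
  move=> Ld; elim: k => [|k IHk]; first by rewrite mulr0.
  by apply: (Ltr _ _ _ _ _ _ Ld IHk); lia.
have [s sP] : exists s, forall n, L x x n -> 0 <= sg s * n.
  apply: contrapT => /forallNP nos.
  have /existsNP[n1 /not_implyP[Ln1 n1P]] := nos true.
  have /existsNP[n2 /not_implyP[Ln2 n2P]] := nos false.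
  (* Multiples of [n1 < 0] and [n2 > 0] are opposite exponents, so [x] is equivalent to a proper
     translate of itself and [zaper] applies. *)
  have := Lit _ `|n1|%N Ln2; have := Lit _ `|n2|%N Ln1.
  rewrite /= in n1P n2P.
  have -> : n1 * `|n2|%:Z = - (n2 * `|n1|%:Z) by lia.
  move=> Lm Lp; set n := n2 * _ in Lm Lp.
  have n_gt0 : 0 < n by rewrite /n; nia.
  have Rp := La _ _ _ Lp Lm.
  have Rm : R true x x (- n) by apply: La => //; rewrite opprK.
  have [R1|R1] := zaper zR n_gt0 (zsub zR Rp) (zsub zR Rm).
    by apply: noL; exists true; apply: LR.
  by apply: noL; exists false; apply: LR.
(* [L'] adds [sigma^a x <= sigma^b x] whenever [0 < sg s * (b - a)]; by [sP] nothing in [L] leads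
   back, so no cycle arises. *)
pose L' u v k := L u v k \/
  exists a b, [/\ L u x a, L x v (k - b) & 0 < sg s * (b - a)].
apply: noL; exists s; apply: (maxL L').
- split.
  + by move=> u v n Ruv; left; apply: LR.
  + move=> v u w m n k [uv|[a [b [ux xv ab]]]] [vw|[c [d [vx xw cd]]]] ->.
    * by left; apply: (Ltr _ _ _ _ _ _ uv vw).
    * right; exists (m + c), (m + d); split.
      - exact: (Ltr _ _ _ _ _ _ uv vx).
      - by apply: (Ltr _ _ _ _ _ _ (L0 x) xw); lia.
      - by case: (s) cd => /=; lia.
    * right; exists a, b; split=> //.
      by apply: (Ltr _ _ _ _ _ _ xv vw); lia.
    * right; exists a, (m + d); split=> //.
        by apply: (Ltr _ _ _ _ _ _ (L0 x) xw); lia.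
      have := sP _ (Ltr _ _ _ _ _ _ xv vx erefl).
      by case: (s) ab cd => /=; lia.
  + move=> u v n [uv|[a [b [ux xv ab]]]] [vu|[c [d [vx xu cd]]]].
    * exact: La.
    * have xv := Ltr _ _ _ _ _ _ xu uv erefl.
      have := sP _ (Ltr _ _ _ _ _ _ xv vx erefl).
      by case: (s) cd => /=; lia.
    * have xu := Ltr _ _ _ _ _ _ xv vu erefl.
      have := sP _ (Ltr _ _ _ _ _ _ xu ux erefl).
      by case: (s) ab => /=; lia.
    * have := sP _ (Ltr _ _ _ _ _ _ xv vx erefl).
      have := sP _ (Ltr _ _ _ _ _ _ xu ux erefl).
      by case: (s) ab cd => /=; lia.
- by left.
- right; exists 0, (sg s); split=> //; first by rewrite subrr.
  by case: (s).
Qed.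

Lemma zextension_total L : zextension L ->
  (forall L', zextension L' -> (forall x y n, L x y n -> L' x y n) ->
    forall x y n, L' x y n -> L x y n) ->
  forall x y n, L x y n \/ L y x (- n).
Proof.
move=> zL maxL x y n; apply: contrapT => /not_orP[nxy nyx].
have [s Ls] := zextension_orbit x zL maxL.
have [LR Ltr La] := zL.
have L0 u : L u u 0 by apply: LR; apply: zrefl.
have Lx (d : int) : 0 <= sg s * d -> L x x d.
  move=> d_ge0; have -> : d = sg s * `|d|%:Z by case: (s) d_ge0 => /=; lia.
  elim: `|d|%N => [|k IHk]; first by rewrite mulr0.
  by apply: (Ltr _ _ _ _ _ _ Ls IHk); lia.
have yx_pos (d : int) : L y x (d - n) -> 0 < sg s * d.
  move=> Ld; rewrite ltNge; apply/negP => d_le0; apply: nyx.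
  by apply: (Ltr _ _ _ _ _ _ Ld (Lx (- d) _)); case: (s) d_le0 => /=; lia.
(* [L'] adds [sigma^i x <= sigma^(i + n) y] for all [i]. By [yx_pos], going on from there to the
   orbit of [x] within [L] ends strictly further in direction [s]. Hence two new relations in a row
   reduce to one, and no cycle closes. *)
pose L' u v k := L u v k \/ exists i, L u x i /\ L y v (k - i - n).
apply: nxy; apply: (maxL L').
- split.
  + by move=> u v m Ruv; left; apply: LR.
  + move=> v u w m p k [uv|[i [ux yv]]] [vw|[j [vx yw]]] ->.
    * by left; apply: (Ltr _ _ _ _ _ _ uv vw).
    * right; exists (m + j); split; first exact: (Ltr _ _ _ _ _ _ uv vx).
      by apply: (Ltr _ _ _ _ _ _ (L0 y) yw); lia.
    * right; exists i; split=> //.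
      by apply: (Ltr _ _ _ _ _ _ yv vw); lia.
    * have /yx_pos ds : L y x ((m + j - i) - n).
        by apply: (Ltr _ _ _ _ _ _ yv vx); lia.
      right; exists (m + j); split.
        by apply: (Ltr _ _ _ _ _ _ ux (Lx _ (ltW ds))); lia.
      by apply: (Ltr _ _ _ _ _ _ (L0 y) yw); lia.
  + move=> u v k [uv|[i [ux yv]]] [vu|[j [vx yu]]].
    * exact: La.
    * have yv := Ltr _ _ _ _ _ _ yu uv erefl.
      have /yx_pos : L y x (0 - n) by apply: (Ltr _ _ _ _ _ _ yv vx); lia.
      by case: (s) => /=; lia.
    * have yu := Ltr _ _ _ _ _ _ yv vu erefl.
      have /yx_pos : L y x (0 - n) by apply: (Ltr _ _ _ _ _ _ yu ux); lia.
      by case: (s) => /=; lia.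
    * have /yx_pos : L y x ((k + j - i) - n).
        by apply: (Ltr _ _ _ _ _ _ yv vx); lia.
      have /yx_pos : L y x ((- k + i - j) - n).
        by apply: (Ltr _ _ _ _ _ _ yu ux); lia.
      by case: (s) => /=; lia.
- by left.
- right; exists 0; split=> //.
  by have -> : n - 0 - n = 0 by lia.
Qed.

Lemma zorder_linearization : exists R' : zrelation G,
  [/\ is_zorder R', ztotal R', forall x y n, R' true x y n <-> R true x y n &
      forall x y n, R false x y n -> R' false x y n].
Proof.
have [L [zL maxL]] := zextension_maximal; have [LR Ltr La] := zL.
pose R' (b : bool) := if b then R true else L.
have totL := zextension_total zL maxL.
exists R'; split=> //; split.
- by move=> [] x /=; [|apply: LR]; apply: zrefl.
- by move=> [] /= y x z m n k xy yz ->; [apply: (ztrans zR xy yz)|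
    apply: (Ltr _ _ _ _ _ _ xy yz)].
- by move=> x y n /= /(zsub zR)/LR.
- by move=> x y n /=; apply: La.
- by move=> x n *; apply: totL.
Qed.

End Linearize.

(** If [R'] holds opposite to [R false], the pair becomes an equivalence of [R'], hence by [zanti]
    belongs to the partial order, which is unchanged. *)
Lemma linearization_exact (G : Type) (R R' : zrelation G) x y n :
  is_zorder R -> is_zorder R' ->
  (forall x y n, R' true x y n <-> R true x y n) ->
  (forall x y n, R false x y n -> R' false x y n) ->
  R false x y n \/ R false y x (- n) -> R' false x y n -> R false x y n.
Proof.
move=> zR zR' RR'1 RR'2 [//|yx] xy; apply: (zsub zR); apply/RR'1.
exact: (zanti zR' xy (RR'2 _ _ _ yx)).
Qed.

(** * The free extension of a partial automorphism *)

Section FreeExtension.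

Variables (A : finType) (le : rel A) (p : A -> option A).
Hypothesis le_refl : reflexive le.
Hypothesis le_tr : transitive le.
Hypothesis le_p : forall x y x' y',
  p x = Some x' -> p y = Some y' -> le x' y' = le x y.

(* [step s x y] means [x <= sigma^(sg s) y]: [step true x y] is generated by
   [v <= sigma u], and [step false x y] by [u <= sigma^-1 v], where
   [p u = Some v]. *)
Definition step (s : bool) : rel A := fun x y =>
  [exists u, exists v, [&& p u == Some v, le x (if s then v else u)
                         & le (if s then u else v) y]].

Fixpoint power (s : bool) (n : nat) : rel A :=
  if n is m.+1 then fun x y => [exists z, step s x z && power s m z y] else le.

(** Steps in a single direction suffice: by [step_cancel], a step followed by an opposite one gives
    nothing beyond [le]. *)
Definition free (x y : A) (n : int) : bool :=
  match n with Posz m => power true m x y | Negz m => power false m.+1 x y end.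

Lemma stepP s x y : reflect (exists u v, [/\ p u = Some v,
    le x (if s then v else u) & le (if s then u else v) y]) (step s x y).
Proof.
apply: (iffP existsP) => [[u /existsP[v /and3P[/eqP]]]|[u [v [uv xu vy]]]].
  by exists u, v.
by exists u; apply/existsP; exists v; rewrite uv eqxx xu vy.
Qed.

Lemma powerSP s n x y :
  reflect (exists2 z, step s x z & power s n z y) (power s n.+1 x y).
Proof.
by apply: (iffP existsP) => [[z /andP[]]|[z xz zy]]; exists z => //; apply/andP.
Qed.

Lemma le_step s x y z : le x y -> step s y z -> step s x z.
Proof.
move=> xy /stepP[u [v [uv yu vz]]]; apply/stepP; exists u, v; split=> //.
exact: le_tr xy yu.
Qed.

Lemma step_le s x y z : step s x y -> le y z -> step s x z.
Proof.
move=> /stepP[u [v [uv xu vy]]] yz; apply/stepP; exists u, v; split=> //.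
exact: le_tr vy yz.
Qed.

Lemma le_power s n x y z : le x y -> power s n y z -> power s n x z.
Proof.
case: n => [|n] /=; first exact: le_tr.
by move=> xy /powerSP[t /(le_step xy) xt tz]; apply/powerSP; exists t.
Qed.

Lemma power_le s n x y z : power s n x y -> le y z -> power s n x z.
Proof.
elim: n x => [|n IHn] x /=; first exact: le_tr.
move=> /powerSP[t xt ty] yz; apply/powerSP; exists t => //; exact: IHn.
Qed.

Lemma step_cancel s x y z : step s x y -> step (~~ s) y z -> le x z.
Proof.
move=> /stepP[u [v [uv xu vy]]] /stepP[u' [v' [uv' yu vz]]].
apply: le_tr xu (le_tr _ vz); case: s vy yu {vz} => /= vy yu.
  by rewrite (le_p uv uv'); apply: le_tr vy yu.
by rewrite -(le_p uv uv'); apply: le_tr vy yu.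
Qed.

Lemma power_add s m n x z : power s (m + n) x z <->
  exists2 y, power s m x y & power s n y z.
Proof.
elim: m x => [|m IHm] x.
  rewrite add0n; split=> [xz|[y]]; last exact: le_power.
  by exists x => //=; apply: le_refl.
rewrite addSn; split.
  move=> /powerSP[t xt /IHm[y ty yz]]; exists y => //.
  by apply/powerSP; exists t.
move=> [y /powerSP[t xt ty] yz]; apply/powerSP; exists t => //.
by apply/IHm; exists y.
Qed.

Lemma freeE s n x y : free x y (sg s * n%:Z) = power s n x y.
Proof.
by case: s; rewrite /sg ?mul1r ?mulN1r //; case: n.
Qed.

Lemma le_free n x y z : le x y -> free y z n -> free x z n.
Proof. by case: n => n; apply: le_power. Qed.

Lemma free_le n x y z : free x y n -> le y z -> free x z n.
Proof. by case: n => n; apply: power_le. Qed.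

Lemma step_free s n x y z : step s x y -> free y z n -> free x z (sg s + n).
Proof.
move=> xy; have [[m ->]|[m ->]] : (exists m : nat, n = sg s * m%:Z) \/
    exists m : nat, n = sg (~~ s) * m.+1%:Z.
- by case: s {xy}; case: n => m; [left; exists m|right; exists m|
    case: m => [|m]; [left; exists 0%N|right; exists m]|left; exists m.+1];
    rewrite /=; lia.
- rewrite freeE => yz; have -> : sg s + sg s * m = sg s * m.+1%:Z by lia.
  by rewrite freeE; apply/powerSP; exists y.
rewrite freeE => /powerSP[t yt tz].
have -> : sg s + sg (~~ s) * m.+1%:Z = sg (~~ s) * m by case: (s) => /=; lia.
by rewrite freeE; apply: le_power tz; apply: step_cancel xy yt.
Qed.

Lemma power_free s m n x y z :
  power s m x y -> free y z n -> free x z (sg s * m%:Z + n).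
Proof.
elim: m x => [|m IHm] x /=; first by rewrite mulr0 add0r; apply: le_free.
move=> /powerSP[t xt ty] /(IHm _ ty)/(step_free xt).
by have -> : sg s + (sg s * m + n) = sg s * m.+1%:Z + n by lia.
Qed.

Lemma free_trans y x z m n : free x y m -> free y z n -> free x z (m + n).
Proof.
have [s [k ->]] : exists s, exists k : nat, m = sg s * k%:Z.
  by case: m => k; [exists true, k | exists false, k.+1]; rewrite /=; lia.
by rewrite freeE; apply: power_free.
Qed.

Lemma power_last s n x y :
  power s n.+1 x y -> exists2 z, power s n x z & step s z y.
Proof.
rewrite -addn1 => /power_add[z xz /powerSP[t zt ty]].
by exists z => //; apply: step_le zt ty.
Qed.

(** There are finitely many relations on [A], so two of the powers coincide; composing with further
    steps carries the coincidence on. *)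
Lemma power_periodic_at s : exists i d : nat, (0 < d)%N /\
  forall n, (i <= n)%N -> power s (n + d) =2 power s n.
Proof.
pose f (n : 'I_(#|{: {ffun A * A -> bool}}|).+1) := [ffun t => power s n t.1 t.2].
have /injectivePn[i0 [j0 ij fij]] : ~~ injectiveb f.
  by apply/injectiveP => /leq_card; rewrite card_ord ltnn.
wlog lt_ij : i0 j0 ij fij / (i0 < j0)%N.
  move=> H; have : (i0 != j0 :> nat) by [].
  by rewrite neq_ltn => /orP[|] lt_ij;
    [apply: (H i0 j0)|apply: (H j0 i0)]; rewrite // eq_sym.
exists i0, (j0 - i0)%N; split; first lia.
have fE x y : power s i0 x y = power s j0 x y.
  by have := congr1 (fun h : {ffun _} => h (x, y)) fij; rewrite !ffunE.
move=> n le_in x y.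
have -> : (n + (j0 - i0) = n - i0 + j0)%N by lia.
rewrite -{2}(subnK le_in).
by apply/idP/idP => /power_add[z xz zy]; apply/power_add; exists z; rewrite ?fE // -fE.
Qed.

Lemma power_periodic : exists2 K : nat, (0 < K)%N &
  forall s k n, (K <= n)%N -> power s (n + k * K) =2 power s n.
Proof.
have [i [d [d_gt0 dP]]] := power_periodic_at true.
have [j [e [e_gt0 eP]]] := power_periodic_at false.
have iter s a c : (forall n, (a <= n)%N -> power s (n + c) =2 power s n) ->
    forall k n, (a <= n)%N -> power s (n + k * c) =2 power s n.
  move=> aP; elim=> [|k IHk] n an x y; first by rewrite mul0n addn0.
  by rewrite mulSn addnCA addnC aP ?IHk //; lia.
(* A common multiple of both periods that also exceeds both preperiods. *)
exists ((i + j).+1 * (d * e))%N; first by rewrite !muln_gt0 d_gt0.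
move=> [] k n Kn.
  rewrite (_ : k * _ = k * ((i + j).+1 * e) * d)%N; last by lia.
  by apply: iter dP _ _ _; nia.
rewrite (_ : k * _ = k * ((i + j).+1 * d) * e)%N; last by lia.
by apply: iter eP _ _ _; nia.
Qed.

End FreeExtension.

(** Induction on the number of points between [x] and [y]: a point [w] between them with [E w w]
    false is not between [x] and [w], so replacing [y] by [w] lowers the count. *)
Lemma dense_loop (T : finType) (E : rel T) (x y : T) : transitive E ->
  (forall u v, E u v -> exists2 w, E u w & E w v) -> E x y ->
  exists w, [/\ E x w, E w w & E w y].
Proof.
move=> trE denE; have [n] := ubnP #|[set u | E u y && E x u]|.
elim: n => // n IHn in y *; rewrite ltnS => cn xy.
have [w xw wy] := denE _ _ xy.
have [ww|nww] := boolP (E w w); first by exists w.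
have [|z [xz zz zw]] := IHn w _ xw.
  apply: leq_trans cn; apply: proper_card; apply/properP; split.
    apply/fintype.subsetP => u; rewrite !inE => /andP[uw ->].
    by rewrite (trE _ _ _ uw wy).
  by exists w; rewrite !inE ?wy ?xw // (negPf nww).
by exists z; split=> //; apply: trE zw wy.
Qed.

Definition wle (A : ordered_poset) (b : bool) : rel A :=
  fun x y => (x == y) || (if b then prec x y else lt x y).

Section WeakOrder.

Variable A : ordered_poset.

Lemma wle_refl b : reflexive (@wle A b).
Proof. by move=> x; rewrite /wle eqxx. Qed.

Lemma wle_trans b : transitive (@wle A b).
Proof.
move=> y x z; rewrite /wle => /predU1P[-> //|xy] /predU1P[<-|yz].
  by rewrite xy orbT.
by apply/orP; right; case: b xy yz; [apply: prec_trans | apply: Defs.lt_trans].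
Qed.

Lemma wle_sub x y : @wle A true x y -> wle false x y.
Proof. by rewrite /wle => /predU1P[->|/lt_prec->]; rewrite ?eqxx ?orbT. Qed.

Lemma wle_total x y : @wle A false x y || wle false y x.
Proof. by rewrite /wle; case/or3P: (Defs.lt_total x y) => ->; rewrite ?orbT. Qed.

Lemma wle_anti x y : @wle A false x y -> wle false y x -> x = y.
Proof.
rewrite /wle => /predU1P[//|xy] /predU1P[//|yx].
by have := Defs.lt_trans xy yx; rewrite Defs.lt_irr.
Qed.

Lemma wle_strict b x y :
  (if b then prec x y else lt x y) = (x != y) && @wle A b x y.
Proof.
rewrite /wle; case: eqVneq => //= ->.
by case: b; rewrite ?prec_irr ?Defs.lt_irr.
Qed.

End WeakOrder.

Lemma wle_paut (A : P1) b (x y x' y' : A) :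
  paut x = Some x' -> paut y = Some y' -> wle b x' y' = wle b x y.
Proof.
have [pinj pprec plt] := pautP A => px py; rewrite /wle.
have -> : (x' == y') = (x == y).
  apply/eqP/eqP => [xy|xy]; first by apply: (pinj _ _ y'); rewrite // -xy.
  by move: px; rewrite xy py => -[].
by case: b; [rewrite (pprec _ _ _ _ px py) | rewrite (plt _ _ _ _ px py)].
Qed.

Section FreeP1.

Variable A : P1.

Definition zfree : zrelation A := fun b => free (wle b) (@paut A).

Lemma zfree0 b x y : zfree b x y 0 = wle b x y. Proof. by []. Qed.

Lemma zfree_trans b y x z m n :
  zfree b x y m -> zfree b y z n -> zfree b x z (m + n).
Proof. exact: (free_trans (@wle_trans A b) (@wle_paut A b)). Qed.

Lemma zfree_paut b x y : paut x = Some y -> zfree b x y (- 1) /\ zfree b y x 1.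
Proof.
move=> xy; split; apply/powerSP.
  by exists y; [apply/stepP; exists x, y|]; rewrite /= ?wle_refl.
by exists x; [apply/stepP; exists x, y|]; rewrite /= ?wle_refl.
Qed.

(** Equivalences in the free extension come from [p] alone: for [0 < n], the two outermost steps
    give [x = p u] with [u] equivalent to [sigma^(n-1) y]. They therefore hold for the partial order
    as well. *)
Lemma zfree_anti_nat x y (n : nat) :
  zfree false x y n%:Z -> zfree false y x (- n%:Z) ->
  [/\ zfree true x y n%:Z, zfree true y x (- n%:Z) &
      (0 < n)%N -> exists u, paut u = Some x].
Proof.
elim: n x y => [|n IHn] x y.
  by rewrite !zfree0 => /wle_anti xy /xy ->; rewrite /zfree /= wle_refl.
have zE z u : zfree false z u (- n.+1%:Z) = power (wle false) (@paut A) false n.+1 z u.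
  by [].
rewrite zE => /powerSP[t /stepP[u [v [uv xv ut]]] ty].
move=> /(power_last (@wle_refl A false) (@wle_trans A false)).
case=> z yz /stepP[u' [v' [uv' zu' vx]]] /=.
rewrite /= in xv ut zu' vx.
have uy : zfree false u y n%:Z.
  exact: (le_free (@wle_trans A false) ut (ty : zfree false t y n%:Z)).
have {z yz zu'}yu' : zfree false y u' (- n%:Z).
  move: yz; rewrite -(freeE _ _ false) mulN1r => yz.
  exact: (free_le (@wle_trans A false) yz zu').
have uu' : wle false u u'.
  by have := zfree_trans uy yu'; rewrite subrr.
have vv' : wle false v v' by rewrite (wle_paut _ uv uv').
have ex : x = v' by apply: wle_anti vx; apply: wle_trans vv'.
have ev : x = v by apply: wle_anti xv _; rewrite ex.
have eu : u = u'.
  by have [pinj _ _] := pautP A; apply: (pinj _ _ x); rewrite ?uv ?uv' -?ev -?ex.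
subst u' v v'; have [Puy Pyu _] := IHn _ _ uy yu'.
have [Pux Pxu] := zfree_paut true uv.
split; last by exists u.
  by have := zfree_trans Pxu Puy; have -> : 1 + n%:Z = n.+1 by lia.
by have := zfree_trans Pyu Pux; have -> : - n%:Z + -1 = - n.+1%:Z by lia.
Qed.

Lemma zfree_zorder : is_zorder zfree.
Proof.
split.
- by move=> b x; rewrite zfree0 wle_refl.
- by move=> b y x z m n k xy yz ->; apply: zfree_trans xy yz.
- have sub s m x y : power (wle true) (@paut A) s m x y ->
      power (wle false) (@paut A) s m x y.
    elim: m x => [|m IHm] x /=; first exact: wle_sub.
    move=> /powerSP[t /stepP[u [v [uv xv ut]]] /IHm ty].
    apply/powerSP; exists t => //.
    by apply/stepP; exists u, v; split=> //; apply: wle_sub.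
  by move=> x y [] n; apply: sub.
- move=> x y [] n xy yx; first by have [] := zfree_anti_nat xy yx.
  rewrite NegzE opprK in yx xy *.
  by have [] := zfree_anti_nat yx xy.
- move=> x [[//|n]|//] _ xx /(zfree_anti_nat xx)[_ _ []// u ux].
  (* Since [u] is [sigma^-1 x], comparing [x] with [u] in the linear order of [A] directs the orbit
     of [x]. *)
  have [xu ux1] := zfree_paut false ux.
  by have /orP[xlu|ulx] := wle_total x u; [right | left];
    [apply: (le_free (@wle_trans A false) xlu xu) |
     apply: (free_le (@wle_trans A false) ux1 ulx)].
Qed.

Lemma zfree_linearization : exists R : zrelation A,
  [/\ is_zorder R, ztotal R, forall x y n, R true x y n <-> zfree true x y n,
      forall b x y, R b x y 0 <-> wle b x y &
      forall b x y, paut x = Some y -> R b x y (- 1) /\ R b y x 1].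
Proof.
have [R [zR totR R1 R2]] := zorder_linearization zfree_zorder.
exists R; split=> // [[] x y|[] x y xy].
- exact: R1.
- split=> xy; last exact: R2.
  apply: (linearization_exact zfree_zorder zR R1 R2 _ xy).
  by rewrite oppr0 !zfree0; apply/orP; apply: wle_total.
- by have [] := zfree_paut true xy; split; apply/R1.
- by have [] := zfree_paut false xy; split; apply/R2.
Qed.

End FreeP1.

(** * Finite pieces and amalgams of invariant orders *)

Lemma P1_embedding_wle (A B : P1) (f : A -> B) :
  (forall b x y, wle b (f x) (f y) = wle b x y) ->
  (forall x y, paut x = Some y -> paut (f x) = Some (f y)) ->
  P1_embedding f.
Proof.
move=> fle fp; split=> //.
have finj : injective f.
  move=> x y fxy; have := fle false x y; have := fle false y x.
  by rewrite fxy wle_refl => /esym yx /esym xy; apply: wle_anti xy yx.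
split=> // x y; first by rewrite (wle_strict true) fle inj_eq // -wle_strict.
by rewrite (wle_strict false) fle inj_eq // -wle_strict.
Qed.

Lemma wle_P1_embedding (A B : P1) (f : A -> B) b x y :
  P1_embedding f -> wle b (f x) (f y) = wle b x y.
Proof.
move=> [[finj fprec flt] _]; rewrite /wle inj_eq //.
by case: b; rewrite ?fprec ?flt.
Qed.

Section Realization.

Variables (G : Type) (R : zrelation G) (T : finType) (g : T -> G) (d : T -> int).
Hypotheses (zR : is_zorder R) (totR : ztotal R).

(** An index [t] stands for the point [sigma^(d t) (g t)]. *)
Let r b t u := `[< R b (g t) (g u) (d u - d t) >].

Let r_refl b t : r b t t.
Proof. by apply/asboolP; rewrite subrr; apply: zrefl. Qed.

Let r_trans b u t v : r b t u -> r b u v -> r b t v.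
Proof.
move=> /asboolP tu /asboolP uv; apply/asboolP.
by apply: (ztrans zR tu uv); lia.
Qed.

Let r_sub t u : r true t u -> r false t u.
Proof. by move=> /asboolP/(zsub zR)/asboolP. Qed.

Let r_total t u : r false t u || r false u t.
Proof.
have [tu|ut] := totR (g t) (g u) (d u - d t); apply/orP; [left | right].
  exact/asboolP.
by apply/asboolP; rewrite -opprB.
Qed.

Let r_anti b t u : r false t u -> r false u t -> r b t u.
Proof.
case: b => // /asboolP tu /asboolP ut; apply/asboolP; apply: (zanti zR tu).
by rewrite opprB.
Qed.

Let eqv t u := r false t u && r false u t.

Let eqv_left t u : eqv t u -> eqv t =1 eqv u.
Proof.
move=> /andP[tu ut] v; apply/andP/andP => -[H1 H2]; split;
  by [apply: r_trans ut _ | apply: r_trans tu | apply: r_trans tu _ | apply: r_trans ut].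
Qed.

Let repr t := odflt t [pick u | eqv t u].

Let eqv_repr t : eqv t (repr t).
Proof. by rewrite /repr; case: pickP => //= _; rewrite /eqv !r_refl. Qed.

Let repr_eq t u : eqv t u -> repr t = repr u.
Proof.
move=> tu; rewrite /repr (eq_pick (eqv_left tu)); case: pickP => //= H.
by have := H u; rewrite /eqv r_refl.
Qed.

Let carr : finType := {t : T | repr t == t}.

Let proj (t : T) : carr := exist (fun t => repr t == t) (repr t)
  (introT eqP (esym (repr_eq (eqv_repr t)))).

Let val_proj t : eqv (val (proj t)) t.
Proof. by have := eqv_repr t; rewrite /eqv andbC. Qed.

Let proj_val (z : carr) : proj (val z) = z.
Proof. by apply: val_inj; apply/eqP; apply: (valP z). Qed.

Let carr_eq (z w : carr) : eqv (val z) (val w) -> z = w.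
Proof.
move=> /repr_eq zw; apply: val_inj.
by rewrite -(eqP (valP z)) zw (eqP (valP w)).
Qed.

Let ord b : rel carr := fun z w => (z != w) && r b (val z) (val w).

Let ord_sub : subrel (ord true) (ord false).
Proof. by move=> z w /andP[zw /r_sub H]; rewrite /ord zw. Qed.

Let ord_irr b : irreflexive (ord b).
Proof. by move=> z; rewrite /ord eqxx. Qed.

Let ord_trans b : transitive (ord b).
Proof.
have weak z w : ord b z w -> r false (val z) (val w).
  by case: b => [/ord_sub|] /andP[].
move=> w z v zw wv; apply/andP; split; last first.
  by case/andP: zw => _ zw; case/andP: wv => _; apply: r_trans zw.
apply/eqP => zv; case/andP: (zw) => /eqP[]; apply: carr_eq.
by rewrite /eqv (weak _ _ zw) zv (weak _ _ wv).
Qed.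

Let ord_total z w : [|| ord false z w, z == w | ord false w z].
Proof.
rewrite /ord [w == z]eq_sym; case: eqVneq => //= _; exact: r_total.
Qed.

Let poset := OrderedPoset (@ord_irr true) (@ord_trans true) (@ord_irr false)
  (@ord_trans false) ord_total ord_sub.

(** The point of [u] is the [sigma]-image of the point of [t]; thus [shift] below is [sigma]
    restricted to the finitely many chosen points. *)
Let next t u :=
  `[< R false (g t) (g u) (d u - d t - 1) /\ R false (g u) (g t) (d t - d u + 1) >].

Let nextW b t u : next t u ->
  R b (g t) (g u) (d u - d t - 1) /\ R b (g u) (g t) (d t - d u + 1).
Proof.
move=> /asboolP[tu ut]; case: b => //.
have E : - (d u - d t - 1) = d t - d u + 1 by lia.
split; apply: (zanti zR) => //; first by rewrite E.
by rewrite -E opprK.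
Qed.

Let next_r b t u t' u' : next t t' -> next u u' -> r b t' u' = r b t u.
Proof.
move=> /(nextW b)[tt' t't] /(nextW b)[uu' u'u]; apply/asboolP/asboolP => H.
  have H' := ztrans zR tt' H erefl.
  by apply: (ztrans zR H' u'u); lia.
have H' := ztrans zR t't H erefl.
by apply: (ztrans zR H' uu'); lia.
Qed.

Let next_eqv t u t' u' : eqv t u -> eqv t' u' -> next t t' -> next u u'.
Proof.
move=> /andP[/asboolP tu /asboolP ut] /andP[/asboolP tu' /asboolP ut'].
move=> /asboolP[tt' t't]; apply/asboolP; split.
  have H := ztrans zR ut tt' erefl.
  by apply: (ztrans zR H tu'); lia.
have H := ztrans zR ut' t't erefl.
by apply: (ztrans zR H tu); lia.
Qed.

Let shift (z : poset) : option poset := [pick w : carr | next (val z) (val w)].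

Let shiftE z w : shift z = Some w <-> next (val z) (val w).
Proof.
rewrite /shift; case: pickP => [v zv|nz]; last by rewrite nz.
split=> [[<-//]|zw]; congr Some; apply: carr_eq.
by rewrite /eqv !(next_r _ zv zw, next_r _ zw zv) r_refl.
Qed.

Let shift_aut : is_partial_aut shift.
Proof.
have inj x y z : shift x = Some z -> shift y = Some z -> x = y.
  move=> /shiftE xz /shiftE yz; apply: carr_eq.
  by rewrite /eqv -(next_r _ xz yz) -(next_r _ yz xz) r_refl.
have pres b (x y x' y' : carr) :
    shift x = Some x' -> shift y = Some y' -> ord b x' y' = ord b x y.
  move=> xx' yy'; rewrite /ord; congr (~~ _ && _).
    apply/eqP/eqP => [E|E]; first by apply: inj yy'; rewrite -E.
    by move: xx'; rewrite E yy' => -[].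
  by apply: next_r; apply/shiftE.
by split=> // x y x' y'; [apply: (pres true) | apply: (pres false)].
Qed.

Lemma realization : exists (D : P1) (h : T -> D),
  [/\ forall z, exists t, h t = z,
      forall b t u, wle b (h t) (h u) <-> R b (g t) (g u) (d u - d t) &
      forall t u, paut (h t) = Some (h u) <->
        R false (g t) (g u) (d u - d t - 1) /\
        R false (g u) (g t) (d t - d u + 1)].
Proof.
exists (MkP1 shift_aut), proj; split.
- by move=> z; exists (val z); apply: proj_val.
- move=> b t u.
  have -> : wle b (proj t : poset) (proj u) = r b (val (proj t)) (val (proj u)).
    rewrite /wle; have -> : (if b then @prec poset (proj t) (proj u) else
      @Defs.lt poset (proj t) (proj u)) = ord b (proj t) (proj u) by case: (b).
    rewrite /ord; case: (eqVneq (proj t) (proj u)) => [->|] //=.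
    by rewrite r_refl.
  have -> : r b (val (proj t)) (val (proj u)) = r b t u.
    have /andP[H1 H2] := val_proj t; have /andP[H3 H4] := val_proj u.
    apply/idP/idP => H.
      by apply: r_trans (r_trans (r_anti b H2 H1) H) (r_anti b H3 H4).
    by apply: r_trans (r_trans (r_anti b H1 H2) H) (r_anti b H4 H3).
  by split=> /asboolP.
- move=> t u; rewrite /= shiftE; split=> [H|H].
    by apply/asboolP; apply: next_eqv H; apply: val_proj.
  have H' : next t u by apply/asboolP.
  by apply: next_eqv H'; have := eqv_repr t; have := eqv_repr u; rewrite /= /eqv andbC.
Qed.

End Realization.

Section Amalgam.

Variables (G B C : Type) (RB : zrelation B) (RC : zrelation C).
Variables (eB : G -> B) (eC : G -> C).
Hypotheses (zB : is_zorder RB) (zC : is_zorder RC).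
Hypothesis agree : forall b x y n,
  RB b (eB x) (eB y) n <-> RC b (eC x) (eC y) n.

Let same b (z z' : B + C) n := match z, z' with
  | inl x, inl y => RB b x y n | inr x, inr y => RC b x y n | _, _ => False end.
Let to b (z : B + C) g n := match z with
  | inl x => RB b x (eB g) n | inr x => RC b x (eC g) n end.
Let from b g (z : B + C) n := match z with
  | inl x => RB b (eB g) x n | inr x => RC b (eC g) x n end.
(** The free amalgam: a relation stays on one side or passes through a translate [sigma^m g] of a
    common point. By [agree], two passages compress to one. *)
Let amalgam : zrelation (B + C) := fun b z z' n =>
  same b z z' n \/ exists g m, to b z g m /\ from b g z' (n - m).

Let same_to b z z' g m n k :
  same b z z' m -> to b z' g n -> k = m + n -> to b z g k.
Proof. by case: z z' => z [] z' //=; apply: ztrans. Qed.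

Let from_same b z z' g m n k :
  from b g z m -> same b z z' n -> k = m + n -> from b g z' k.
Proof. by case: z z' => z [] z' //=; apply: ztrans. Qed.

Let same_trans b z' z z'' m n k :
  same b z z' m -> same b z' z'' n -> k = m + n -> same b z z'' k.
Proof. by case: z z' z'' => z [] z' [] z'' //=; apply: ztrans. Qed.

Let from_to b z g g' m n k :
  from b g z m -> to b z g' n -> k = m + n -> RB b (eB g) (eB g') k.
Proof. by case: z => z /= gz zg' E; [|apply/agree]; apply: ztrans gz zg' E. Qed.

Let to_base b z g g' m n k :
  to b z g m -> RB b (eB g) (eB g') n -> k = m + n -> to b z g' k.
Proof. by case: z => z /= zg => [|/agree]; apply: ztrans zg. Qed.

Let base_from b z g g' m n k :
  RB b (eB g) (eB g') m -> from b g' z n -> k = m + n -> from b g z k.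
Proof. by case: z => z /= => [|/agree]; apply: ztrans. Qed.

Let amalgam_same b c z z' k n :
  same c z z' k \/ same c z' z k -> amalgam b z z' n -> same b z z' n.
Proof.
move=> side [//|[g [m [zg gz']]]].
by case: z z' side zg gz' => z [] z' /= [] // _ zg gz'; apply: ztrans zg gz' _ => //; lia.
Qed.

Let amalgam_zorder : is_zorder amalgam.
Proof.
have anti z z' n : same false z z' n -> same false z' z (- n) -> same true z z' n.
  by case: z z' => z [] z' //=; apply: zanti.
have to_anti z g m : to false z g m -> from false g z (- m) -> to true z g m.
  by case: z => z /=; apply: zanti.
have from_anti z g m : from false g z m -> to false z g (- m) -> from true g z m.
  by case: z => z /=; apply: zanti.
split.
- by move=> b [] x; left; [apply: (zrefl zB)|apply: (zrefl zC)].
- move=> b z' z z'' m n k [zz'|[g [i [zg gz']]]] [zz''|[g' [j [zg' gz'']]]] ->.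
  + by left; apply: same_trans zz' zz'' _.
  + right; exists g', (m + j); split; first exact: same_to zz' zg' _.
    by rewrite (_ : _ - _ = n - j) //; lia.
  + right; exists g, i; split=> //.
    by apply: from_same gz' zz'' _; lia.
  + have gg' := from_to gz' zg' erefl.
    right; exists g', (m + j); split; first by apply: to_base zg gg' _; lia.
    by rewrite (_ : _ - _ = n - j) //; lia.
- move=> z z' n [zz'|[g [m [zg gz']]]]; [left | right].
    by case: z z' zz' => z [] z' //=; apply: zsub.
  exists g, m; case: z zg => z; case: z' gz' => z' /= H1 H2;
    by split; apply: zsub.
- move=> z z' n zz' z'z; case: (zz') => [H|[g [m [zg gz']]]].
    left; apply: (anti _ _ _ H); apply: amalgam_same z'z.
    by right; apply: H.
  case: (z'z) => [H|[g' [m' [zg' g'z]]]].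
    left; apply: (anti _ _ _ _ H); apply: amalgam_same zz'.
    by right; apply: H.
  have gg' := from_to gz' zg' erefl; have g'g := from_to g'z zg erefl.
  right; exists g, m; split.
    by apply: to_anti zg _; apply: base_from gg' g'z _; lia.
  by apply: from_anti gz' _; apply: to_base zg' g'g _; lia.
- move=> z n n_gt0 zz zz'.
  have self : same false z z 0 \/ same false z z 0.
    by left; case: z {zz zz'} => z; [apply: (zrefl zB)|apply: (zrefl zC)].
  have {}zz := amalgam_same self zz; have {}zz' := amalgam_same self zz'.
  by case: z zz zz' {self} => z /= zz zz';
    [have [] := zaper zB n_gt0 zz zz' | have [] := zaper zC n_gt0 zz zz'] => H;
    [left | right | left | right]; left.
Qed.

(** As [RB] and [RC] are total, two elements of the same side are already comparable in the free
    amalgam, so linearizing it alters neither side. *)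
Lemma zorder_amalgamation : ztotal RB -> ztotal RC ->
  exists R : zrelation (B + C),
  [/\ is_zorder R /\ ztotal R,
      forall b x y n, R b (inl x) (inl y) n <-> RB b x y n,
      forall b x y n, R b (inr x) (inr y) n <-> RC b x y n &
      forall b g, R b (inl (eB g)) (inr (eC g)) 0 /\
                  R b (inr (eC g)) (inl (eB g)) 0].
Proof.
move=> totB totC.
have [R [zR totR R1 R2]] := zorder_linearization amalgam_zorder.
exists R; split=> //.
- have amB b x y n : amalgam b (inl x) (inl y) n <-> RB b x y n.
    split=> [|xy]; last by left.
    by move=> [//|[g [m [/= xg gy]]]]; apply: (ztrans zB xg gy); lia.
  case=> x y n; first by split=> [/R1/amB|/amB/R1].
  split=> [H|/amB/R2//]; apply/amB.
  by apply: (linearization_exact amalgam_zorder zR R1 R2 _ H); rewrite !amB.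
- have amC b x y n : amalgam b (inr x) (inr y) n <-> RC b x y n.
    split=> [|xy]; last by left.
    by move=> [//|[g [m [/= xg gy]]]]; apply: (ztrans zC xg gy); lia.
  case=> x y n; first by split=> [/R1/amC|/amC/R1].
  split=> [H|/amC/R2//]; apply/amC.
  by apply: (linearization_exact amalgam_zorder zR R1 R2 _ H); rewrite !amC.
- have glue b g : amalgam b (inl (eB g)) (inr (eC g)) 0 /\
      amalgam b (inr (eC g)) (inl (eB g)) 0.
    by split; right; exists g, 0; rewrite subrr; split;
      [apply: (zrefl zB)|apply: (zrefl zC)|apply: (zrefl zC)|apply: (zrefl zB)].
  by move=> [] g; have [? ?] := glue true g; have [? ?] := glue false g;
    split; by [apply/R1 | apply: R2].
Qed.

End Amalgam.

(** * Finitely determined extensions *)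

Section Limits.

Variables (G : Type) (R : zrelation G) (K : nat).
Hypotheses (zR : is_zorder R) (K_gt0 : (0 < K)%N).

(* [inr (y, s)] is a new element [v] with [sigma^(s K) v <= v], a least upper
   bound of the [sigma^(s m K) y] with [m >= 1]. *)
Let limits : zrelation (G + G * bool) := fun b z z' n => match z, z' with
  | inl x, inl y => R b x y n
  | inl x, inr (y, s) =>
      if b then exists m : nat, R true x y (n + sg s * (m.+1 * K)%N%:Z)
      else exists m, R false x y m
  | inr v, inr w => v = w /\
      if b then exists m : nat, n = - sg v.2 * (m * K)%N%:Z else sg v.2 * n <= 0
  | inr _, inl _ => False
  end.

Let limits_zorder : is_zorder limits.
Proof.
split.
- case=> [] [x|v] //=; try exact: (zrefl zR).
    by split=> //; exists 0%N; lia.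
  by rewrite mulr0.
- case=> [] [y|[y s]] [x|[x s']] [z|[z s'']] m n k //=.
  + exact: ztrans.
  + move=> xy [i yz] ->; exists i; apply: (ztrans zR xy yz); lia.
  + move=> [i xy] [[<- <-] [j ->]] ->; exists (i + j)%N.
    by apply: (ztrans zR xy (zrefl zR _ _)); case: (s) => /=; lia.
  + move=> [[-> ->] [i ->]] [[<- <-] [j ->]] ->; split=> //; exists (i + j)%N.
    by case: (s) => /=; lia.
  + exact: ztrans.
  + by move=> xy [i yz] _; exists (m + i); apply: (ztrans zR xy yz).
  + by move=> [i xy] [[<- _] _] _; exists i.
  + move=> [[-> ->] ms] [[<- <-] ns] ->; split=> //.
    by case: (s) ms ns => /=; lia.
- move=> [x|v] [y|[y s]] n //=; first exact: zsub.
    by move=> [m xy]; exists (n + sg s * (m.+1 * K)%N); apply: zsub.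
  by move=> [-> [m ->]]; split=> //; case: (s) => /=; lia.
- move=> [x|[x s]] [y|[y s']] n //=; first exact: zanti.
  move=> [[-> ->] n1] [_ n2]; split=> //; exists 0%N.
  by case: (s') n1 n2 => /=; lia.
- move=> [x|v] n /=; first exact: zaper.
  by move=> _ _ _; case: v.2; [right | left].
Qed.

(** One relation with a limit [inr (y, s)] encodes infinitely many: its failure at [n] means that
    [x <= sigma^k y] fails for every [k = n + sg s * (m.+1 * K)]. *)
Lemma zorder_limits : ztotal R -> exists N : zrelation (G + G * bool),
  [/\ is_zorder N /\ ztotal N,
      forall b x y n, N b (inl x) (inl y) n <-> R b x y n,
      forall x y s n, N true (inl x) (inr (y, s)) n <->
        exists m : nat, R true x y (n + sg s * (m.+1 * K)%N%:Z) &
      forall v, N true (inr v) (inr v) (- sg v.2 * K%:Z)].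
Proof.
move=> totR; have [N [zN totN N1 N2]] := zorder_linearization limits_zorder.
exists N; split=> //.
- case=> x y n; first exact: N1.
  split=> [H|xy]; last exact: N2.
  by apply: (linearization_exact limits_zorder zN N1 N2 _ H); apply: totR.
- by move=> v; apply/N1; split=> //; exists 1%N; rewrite mul1n.
Qed.

End Limits.

Definition zagree (G : Type) (W : nat) (N N' : zrelation G) : Prop :=
  forall b x y n, (`|n| <= W)%N -> N b x y n <-> N' b x y n.

Lemma zdetermined (A : P1) : exists (K : nat) (N0 : zrelation (A + A * bool)),
  [/\ (0 < K)%N, is_zorder N0 /\ ztotal N0,
      (forall b x y, N0 b (inl x) (inl y) 0 <-> wle b x y) /\
      (forall b x y, paut x = Some y ->
         N0 b (inl x) (inl y) (- 1) /\ N0 b (inl y) (inl x) 1),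
      forall v, N0 true (inr v) (inr v) (- sg v.2 * K%:Z) &
      forall N, is_zorder N -> zagree (3 * K) N N0 -> forall x y n,
        N true (inl x) (inl y) n <-> N0 true (inl x) (inl y) n].
Proof.
have [K K_gt0 perK] := power_periodic (@paut A) (@wle_refl A true) (@wle_trans A true).
have [R [zR totR Rfree R0 Rpaut]] := zfree_linearization A.
have [N0 [[zN0 totN0] N0l N0lim N0v]] := zorder_limits zR K_gt0 totR.
exists K, N0; split=> //.
  by split=> [b x y|b x y /(Rpaut b)[xy yx]]; [rewrite N0l R0|split; apply/N0l].
set pw := power _ _ in perK.
have pw_add s m n x z :
    pw s (m + n)%N x z <-> exists2 y, pw s m x y & pw s n y z.
  exact: power_add (@wle_refl A true) (@wle_trans A true) _ _ _ _ _.
have N0pw s n x y : N0 true (inl x) (inl y) (sg s * n%:Z) <-> pw s n x y.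
  by rewrite N0l Rfree /zfree freeE.
(* Transitivity and density both come from the equality of the powers [K + K] and [K]. *)
have loop_tr s : transitive (pw s K).
  move=> y x z xy yz; rewrite -(perK s 1%N K) // mul1n.
  by apply/pw_add; exists y.
have loop_dense s x y : pw s K x y -> exists2 z, pw s K x z & pw s K z y.
  rewrite -(perK s 1%N K) // mul1n.
  by move/pw_add.
move=> N zN NN0 x y n.
have [nW|nW] := leqP `|n| (3 * K); first exact: NN0.
have [s [n' En]] : exists s, exists n' : nat, n = sg s * n'%:Z.
  by case: n {nW} => k; [exists true, k | exists false, k.+1]; rewrite /=; lia.
have {nW} n'W : (3 * K < n')%N by move: nW; rewrite En; case: (s) => /=; lia.
subst n; rewrite N0pw.
pose r := (n' %% K)%N; pose t := (n' %/ K)%N.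
have En' : n' = (t * K + r)%N by apply: divn_eq.
have r_lt : (r < K)%N by rewrite ltn_mod.
have t_gt : (2 < t)%N by nia.
split=> [Nxy|xy].
  apply: contrapT => nxy.
  (* By periodicity, failure at [n'] is failure at every [r + K + m * K], that is, failure of one
     relation with the limit of [y], visible in the window. In [N], the relation [Nxy] followed by
     [y <= sigma^(- sg s * t * K) v], where [v] is that limit, would contradict it. *)
  have : ~ N0 true (inl x) (inr (y, s)) (sg s * r%:Z).
    rewrite N0lim => -[m]; rewrite -N0l.
    have -> : sg s * r%:Z + sg s * (m.+1 * K)%N%:Z = sg s * (r + K + m * K)%N%:Z by lia.
    rewrite N0pw perK; last lia.
    move=> xy; apply: nxy; rewrite En'.
    by rewrite (_ : _ + r = r + K + t.-1 * K)%N ?perK //; nia.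
  apply; apply/NN0; first by case: (s) => /=; lia.
  have yv : N true (inl y) (inr (y, s)) (- sg s * K%:Z).
    apply/NN0; first by case: (s) => /=; lia.
    by apply/N0lim; exists 0%N; rewrite mul1n mulNr addNr; apply: zrefl.
  have vv : N true (inr (y, s)) (inr (y, s)) (- sg s * K%:Z).
    by apply/NN0; [case: (s) => /=; lia | apply: N0v].
  have yv' := ztrans zN yv (ziter t.-1 zN vv) erefl.
  apply: (ztrans zN Nxy yv'); rewrite En'.
  have -> : (t * K)%N = (K + t.-1 * K)%N by nia.
  by case: (s) => /=; lia.
have /pw_add[z xz zy] : pw s (K + (n' - K))%N x y
  by rewrite subnKC //; lia.
(* The path from [x] to [y] is rerouted: [K] steps to [w], then [t - 3] turns of the loop at [w],
   then [K + (r + K)] steps to [y]. Each piece is shorter than [3 * K], hence seen in the window. *)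
have [w [xw ww wz]] := dense_loop (loop_tr s) (loop_dense s) xz.
have wy : pw s (K + (r + K))%N w y.
  apply/pw_add; exists z => //.
  rewrite -(perK s (t - 2)%N); last lia.
  by rewrite (_ : _ + _ = n' - K)%N //; nia.
have Nxw : N true (inl x) (inl w) (sg s * K%:Z).
  by apply/NN0; [case: (s) => /=; lia | apply/N0pw].
have Nww : N true (inl w) (inl w) (sg s * K%:Z).
  by apply/NN0; [case: (s) => /=; lia | apply/N0pw].
have Nwy : N true (inl w) (inl y) (sg s * (K + (r + K))%N%:Z).
  by apply/NN0; [case: (s) => /=; lia | apply/N0pw].
have Nxw' := ztrans zN Nxw (ziter (t - 3) zN Nww) erefl.
apply: (ztrans zN Nxw' Nwy); rewrite En'.
have -> : (t * K)%N = (K + K + K + (t - 3) * K)%N by nia.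
by case: (s) => /=; lia.
Qed.

Definition literal (v : bool) (P : Prop) : Prop := if v then P else ~ P.

Lemma progression_monotone (d : int -> Prop) (K : nat) (s : bool) (r m m' : int) :
  (forall n, d n -> d (n + sg s * K%:Z)) -> 0 <= sg s * (m' - m) ->
  d (r + m * K%:Z) -> d (r + m' * K%:Z).
Proof.
move=> dmon le_mm'; have [k ->] : exists k : nat, m' = m + sg s * k%:Z.
  by exists `|m' - m|%N; case: (s) le_mm' => /=; lia.
elim: k => [|k IHk] dm; first by rewrite mulr0 addr0.
have := dmon _ (IHk dm); have -> // : r + (m + sg s * k) * K + sg s * K =
  r + (m + sg s * k.+1) * K by lia.
Qed.

(** If [d] and [d'] differed at [m], the one that is false there would take both values inside the
    window, and monotonicity would place [m] between the two witnesses, hence in the window, where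
    [d] and [d'] agree. *)
Lemma progression_agree (d d' : int -> Prop) (K L : nat) (s : bool) (r m : int) :
  (forall n, d n -> d (n + sg s * K%:Z)) ->
  (forall n, d' n -> d' (n + sg s * K%:Z)) ->
  (forall n, (`|n| <= L)%N -> d n <-> d' n) ->
  (forall v m, literal v (d (r + m * K%:Z)) \/ literal v (d' (r + m * K%:Z)) ->
     exists m', (`|(r + m' * K%:Z)%R| <= L)%N /\ literal v (d' (r + m' * K%:Z))) ->
  d (r + m * K%:Z) <-> d' (r + m * K%:Z).
Proof.
move=> dmon d'mon dd' wit.
have key (e e' : int -> Prop) : (forall n, e n -> e (n + sg s * K%:Z)) ->
    (forall n, e' n -> e' (n + sg s * K%:Z)) ->
    (forall n, (`|n| <= L)%N -> e n <-> e' n) ->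
    (forall v, literal v (e (r + m * K%:Z)) \/ literal v (e' (r + m * K%:Z)) ->
     exists m', (`|(r + m' * K%:Z)%R| <= L)%N /\ literal v (e' (r + m' * K%:Z))) ->
    e (r + m * K%:Z) -> e' (r + m * K%:Z).
  move=> emon e'mon ee' ewit em; apply: contrapT => ne'm.
  have [m1 [m1L e'm1]] := ewit true (or_introl em).
  have [m2 [m2L e'm2]] := ewit false (or_intror ne'm).
  rewrite /= in e'm1 e'm2.
  have lt_m1 : sg s * (m - m1) < 0.
    by rewrite ltNge; apply/negP => H; apply/ne'm/(progression_monotone e'mon H).
  have lt_m2 : sg s * (m2 - m) < 0.
    rewrite ltNge; apply/negP => H; apply/e'm2/ee' => //.
    exact: (progression_monotone emon H).
  apply/ne'm/ee' => //; case: (s) lt_m1 lt_m2 => /=; nia.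
split; first by apply: key => // v; apply: wit.
apply: key => // [n nL|v [H|H]]; first by split=> /(dd' _ nL).
  have [m' [m'L Hm']] := wit v m (or_intror H); exists m'; split=> //.
  by case: v Hm' {H} => /= [/(dd' _ m'L)//|H /(dd' _ m'L)].
have [m' [m'L Hm']] := wit v m (or_introl H); exists m'; split=> //.
by case: v Hm' {H} => /= [/(dd' _ m'L)//|H' /(dd' _ m'L)].
Qed.

Section Maximal.

Variables (G : finType) (K W : nat) (N0 : zrelation G).
Hypotheses (K_gt0 : (0 < K)%N) (K_le : (K <= W)%N).
Hypotheses (zN0 : is_zorder N0) (totN0 : ztotal N0).

Let admissible N := [/\ is_zorder N, ztotal N & zagree W N N0].

Hypothesis pairs : forall x y,
  (forall N, admissible N -> forall n, N true x y n <-> N0 true x y n) \/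
  exists s, N0 true x x (sg s * K%:Z) \/ N0 true y y (sg s * K%:Z).

(** A fact [(b, v, x, y, r)] records that the relation [b] between [x] and [y] takes the truth value
    [v] somewhere on the residue class of [r] modulo [K]. *)
Let fact : finType := (bool * bool * G * G * 'I_K)%type.
Let holds (N : zrelation G) (f : fact) (m : int) : Prop :=
  let: (b, v, x, y, r) := f in literal v (N b x y (r%:Z + m * K%:Z)).
Let offset (f : fact) (m : int) : int := f.2%:Z + m * K%:Z.
Let facts N : {set fact} := [set f | `[< exists m, holds N f m >]].

Let admissible_mono N b x y s : admissible N ->
  N b x x (sg s * K%:Z) \/ N b y y (sg s * K%:Z) ->
  forall n, N b x y n -> N b x y (n + sg s * K%:Z).
Proof.
move=> [zN _ _] [xx|yy] n xy; first by apply: (ztrans zN xx xy); lia.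
exact: (ztrans zN xy yy).
Qed.

(** [N1] is an admissible order with the most facts, and [L] is large enough to show a witness of
    each of them. *)
Lemma zmaximal : exists (N1 : zrelation G) (L : nat),
  [/\ is_zorder N1 /\ ztotal N1, (W <= L)%N, zagree W N1 N0 &
      forall N, is_zorder N -> ztotal N -> zagree L N N1 ->
        forall b x y n, N b x y n <-> N1 b x y n].
Proof.
pose P n := `[< exists2 N, admissible N & #|facts N| = n >].
have exP : exists n, P n by exists #|facts N0|; apply/asboolP; exists N0.
have boundP n : P n -> (n <= #|fact|)%N.
  by move=> /asboolP[N _ <-]; apply: max_card.
case: (ex_maxnP exP boundP) => c /asboolP[N1 admN1 cN1] maxN1.
have [zN1 totN1 agN1] := admN1.
have [l lP] : exists l : fact -> nat, forall f, f \in facts N1 ->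
    exists2 m, holds N1 f m & (`|offset f m| <= l f)%N.
  apply: (@fin_all_exists fact (fun=> nat) (fun f l => f \in facts N1 ->
    exists2 m, holds N1 f m & (`|offset f m| <= l)%N)) => f.
  have [|_] := boolP (f \in facts N1); last by exists 0%N.
  by rewrite inE => /asboolP[m fm]; exists `|offset f m|%N => _; exists m.
pose L := maxn W (\max_f l f).
have WL : (W <= L)%N by apply: leq_maxl.
exists N1, L; split=> // N zN totN agN.
have admN : admissible N.
  split=> // b x y n nW; split=> [/agN|/agN1 H]; last by apply/agN; [lia|apply: H].
  by move=> H; apply/agN1 => //; apply: H; lia.
have wit1 b v x y r : (exists m, literal v (N1 b x y (r%:Z + m * K%:Z))) ->
    (r < K)%N -> exists m, (`|(r%:Z + m * K%:Z)%R| <= L)%N /\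
      literal v (N1 b x y (r%:Z + m * K%:Z)).
  move=> [m Hm] rK; have [|m' Hm' m'l] := lP (b, v, x, y, Ordinal rK).
    by rewrite inE; apply/asboolP; exists m.
  exists m'; split=> //; apply: leq_trans m'l _.
  by apply: leq_trans (leq_maxr _ _); apply: (leq_bigmax (F := l)).
(* The window shows all facts of [N1], so [N] has them too, and by maximality it has no others. *)
have factsE : facts N = facts N1.
  apply/esym/eqP; rewrite eqEcard; apply/andP; split; last first.
    by rewrite cN1; apply: maxN1; apply/asboolP; exists N.
  apply/fintype.subsetP => -[[[[b v] x] y] [r rK]].
  rewrite !inE => -[m Hm].
  have [m' [m'L Hm']] := wit1 b v x y r (ex_intro _ m Hm) rK.
  have NE := agN b x y _ m'L.
  by exists m'; case: v {Hm} Hm' => /= [/NE|H /NE].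
move=> b x y n; have nE : n = (n %% K)%Z + (n %/ K)%Z * K%:Z.
  by rewrite addrC -divz_eq.
have [r rE] : exists r : nat, (n %% K)%Z = r%:Z.
  by exists `|(n %% K)%Z|%N; rewrite gez0_abs // modz_ge0 //; lia.
have rK : (r < K)%N by rewrite -ltz_nat -rE ltz_pmod.
rewrite rE in nE; move: (n %/ K)%Z nE => m -> {n rE}.
have [[-> fixed]|[s loop]] : (b = true /\
     forall N, admissible N -> forall n, N true x y n <-> N0 true x y n) \/
    exists s, N1 b x x (sg s * K%:Z) \/ N1 b y y (sg s * K%:Z).
- case: b; last first.
    (* In the linear order totality directs every orbit, so each pair is monotone along residue
       classes. *)
    right; have [x1|x1] := totN1 x x 1; [exists true|exists false]; left;
    by have := ziter K zN1 x1; rewrite ?mul1r.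
  have [fixed|[s loop]] := pairs x y; first by left.
  by right; exists s; case: loop => H; [left | right]; apply/agN1 => //;
    case: (s) => /=; lia.
- by split=> [/(fixed _ admN)/(fixed _ admN1)|/(fixed _ admN1)/(fixed _ admN)].
have loopN : N b x x (sg s * K%:Z) \/ N b y y (sg s * K%:Z).
  by case: loop => H; [left | right]; apply/agN => //; case: (s) => /=; lia.
apply: (@progression_agree (N b x y) (N1 b x y) K L s).
- exact: (admissible_mono admN loopN).
- exact: (admissible_mono admN1 loop).
- by move=> n; apply: agN.
move=> v {}m [H|H]; apply: wit1 => //; last by exists m.
have : (b, v, x, y, Ordinal rK) \in facts N.
  by rewrite inE; apply/asboolP; exists m.
by rewrite factsE inE => /asboolP.
Qed.

End Maximal.

(** Pairs from [A] are settled by [zdetermined]; any other pair contains a limit, whose loop of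
    length [K] gives monotonicity. *)
Lemma zdetermining (A : P1) :
  exists (G : finType) (i : A -> G) (N : zrelation G) (L : nat),
  [/\ is_zorder N /\ ztotal N,
      forall b x y, N b (i x) (i y) 0 <-> wle b x y,
      forall b x y, paut x = Some y ->
         N b (i x) (i y) (- 1) /\ N b (i y) (i x) 1 &
      forall N', is_zorder N' -> ztotal N' -> zagree L N' N ->
        forall b x y n, N' b x y n <-> N b x y n].
Proof.
have [K [N0 [K_gt0 [zN0 totN0] [N0_0 N0_paut] N0v N0l]]] := zdetermined A.
have K_le : (K <= 3 * K)%N by lia.
have [x y|N1 [L [[zN1 totN1] WL agN1 N1P]]] := zmaximal K_gt0 K_le zN0 totN0.
- case: x y => [x|v] [y|w].
  + by left=> N [zN _ agN] n; apply: N0l.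
  + by right; exists (~~ w.2); right; have := N0v w; case: w.2.
  + by right; exists (~~ v.2); left; have := N0v v; case: v.2.
  + by right; exists (~~ w.2); right; have := N0v w; case: w.2.
exists (A + A * bool)%type, inl, N1, L; split=> // b x y; first by rewrite agN1.
by move=> /(N0_paut b)[xy yx]; split; apply/agN1 => //; lia.
Qed.

(** * Amalgamation *)

Section Window.

Variables (G : finType) (N : zrelation G) (L : nat) (A : P1).
Variable h : G * 'I_(L + L).+1 -> A.
Hypothesis zN : is_zorder N.
Hypothesis h_wle : forall b t u,
  wle b (h t) (h u) <-> N b t.1 u.1 ((u.2%:Z - L%:Z) - (t.2%:Z - L%:Z)).
Hypothesis h_paut : forall t u, paut (h t) = Some (h u) <->
  N false t.1 u.1 ((u.2%:Z - L%:Z) - (t.2%:Z - L%:Z) - 1) /\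
  N false u.1 t.1 ((t.2%:Z - L%:Z) - (u.2%:Z - L%:Z) + 1).

Variables (B : P1) (f : A -> B) (R : zrelation B).
Hypothesis emb_f : P1_embedding f.
Hypothesis zR : is_zorder R.
Hypothesis R_wle : forall b x y, R b x y 0 <-> wle b x y.
Hypothesis R_paut : forall b x y,
  paut x = Some y -> R b x y (- 1) /\ R b y x 1.

(* [F y k] is [sigma^(k - L) y] in the orbit of the generator [y]. *)
Let F y k : B := f (h (y, inord k)).

Let window_shift b y j k : (k + j <= L + L)%N ->
  R b (F y k) (F y (k + j)) (- j%:Z) /\ R b (F y (k + j)) (F y k) j%:Z.
Proof.
elim: j => [|j IHj] kj; first by rewrite addn0; split; apply: zrefl.
have [|kF Fk] := IHj; first by lia.
have [FS SF] : R b (F y (k + j)) (F y (k + j.+1)) (- 1) /\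
    R b (F y (k + j.+1)) (F y (k + j)) 1.
  apply: R_paut; have [_ fp] := emb_f; apply/fp/h_paut.
  rewrite /= !inordK ?ltnS; [|lia|lia].
  by split; rewrite (_ : _ + _ = 0); try lia; apply: zrefl.
by split; [apply: (ztrans zR kF FS) | apply: (ztrans zR SF Fk)]; lia.
Qed.

(** Consecutive points of the window are linked by [paut], and [f] preserves these links. *)
Lemma window_orbit b y (k : 'I_(L + L).+1) :
  R b (f (h (y, k))) (F y L) (k%:Z - L%:Z) /\
  R b (F y L) (f (h (y, k))) (L%:Z - k%:Z).
Proof.
have -> : f (h (y, k)) = F y k by rewrite /F inord_val.
have [kL|/ltnW Lk] := leqP k L.
  have [|H1 H2] := @window_shift b y (L - k)%N k; first lia.
  rewrite subnKC // in H1 H2.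
  have <- : - (L - k)%N%:Z = k%:Z - L%:Z by lia.
  by have <- : (L - k)%N%:Z = L%:Z - k%:Z by lia.
have [|H1 H2] := @window_shift b y (k - L)%N L; first by have := ltn_ord k; lia.
rewrite subnKC // in H1 H2.
have <- : - (k - L)%N%:Z = L%:Z - k%:Z by lia.
by have <- : (k - L)%N%:Z = k%:Z - L%:Z by lia.
Qed.

(** For [n] between [-L] and [L], the point [sigma^n y] is itself in the window, at index [L + n],
    so the relation is one of [A], which [f] preserves. *)
Lemma window_agree : zagree L (fun b x y => R b (F x L) (F y L)) N.
Proof.
move=> b x y n nL; pose k := inord (absz (L%:Z + n)) : 'I_(L + L).+1.
have kE : k%:Z = L%:Z + n by rewrite inordK; lia.
have [kF Fk] := window_orbit b y k; rewrite kE in kF Fk.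
have <- : R b (F x L) (f (h (y, k))) 0 <-> R b (F x L) (F y L) n.
  by split=> H; [apply: (ztrans zR H kF) | apply: (ztrans zR H Fk)]; lia.
rewrite R_wle wle_P1_embedding // h_wle /= kE inordK ?ltnS ?leq_addr //.
by have -> : L%:Z + n - L%:Z - (L%:Z - L%:Z) = n by lia.
Qed.

End Window.

Theorem theorem3p13 : @CAP P1 (fun A : P1 => A : Type) P1_embedding.
Proof.
move=> A0; have [G [i [N [L [[zN totN] N_wle N_paut det]]]]] := zdetermining A0.
(* [A] consists of the [sigma^k x] with [x] in [G] and [-L <= k <= L]; the index [inord L] is
   exponent 0. *)
have [A [h [h_onto h_wle h_paut]]] := @realization G N (G * 'I_(L + L).+1)%type
  fst (fun t => t.2%:Z - L%:Z) zN totN.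
exists A, (fun x => h (i x, inord L)); split.
  apply: P1_embedding_wle => [b x y|x y /(N_paut false)[xy yx]].
    by apply/idP/idP => [/h_wle|/N_wle H]; [|apply/h_wle]; rewrite subrr // => /N_wle.
  by apply/h_paut; rewrite /= subrr.
move=> B C f g emb_f emb_g.
have [RB [zB totB _ RB_wle RB_paut]] := zfree_linearization B.
have [RC [zC totC _ RC_wle RC_paut]] := zfree_linearization C.
pose eB x := f (h (x, inord L)); pose eC x := g (h (x, inord L)).
have pullback (X : Type) (e : G -> X) (R : zrelation X) : is_zorder R -> ztotal R ->
    is_zorder (fun b x y => R b (e x) (e y)) /\ ztotal (fun b x y => R b (e x) (e y)).
  move=> zR totR; split=> [|x y n]; last exact: totR.
  split=> [b x|b y x z m n k|x y n|x y n|x n].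
  - exact: zrefl.
  - exact: ztrans.
  - exact: zsub.
  - exact: zanti.
  - exact: zaper.
(* Pulled back to [G], both [RB] and [RC] agree with [N] on the window, hence everywhere by
   [det]. *)
have agB := window_agree zN h_wle h_paut emb_f zB RB_wle RB_paut.
have agC := window_agree zN h_wle h_paut emb_g zC RC_wle RC_paut.
have [zB' totB'] := pullback _ eB _ zB totB.
have [zC' totC'] := pullback _ eC _ zC totC.
have [|R [[zR totR] RlE RrE glue]] :=
  @zorder_amalgamation G B C RB RC eB eC zB zC _ totB totC.
  by move=> b x y n; rewrite (det _ zB' totB' agB) (det _ zC' totC' agC).
(* With all exponents 0, [D] keeps just the points of [B] and [C], identified when equivalent in
   [R]. *)
have [D [q [_ q_wle q_paut]]] :=
  @realization (B + C)%type R (B + C)%type id (fun=> 0) zR totR.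
exists D, (q \o inl), (q \o inr); split.
- apply: P1_embedding_wle => [b x y|x y /(RB_paut false)[xy yx]] /=.
    by apply/idP/idP => [/q_wle|/RB_wle H]; [|apply/q_wle]; rewrite RlE // => /RB_wle.
  by apply/q_paut; rewrite !RlE.
- apply: P1_embedding_wle => [b x y|x y /(RC_paut false)[xy yx]] /=.
    by apply/idP/idP => [/q_wle|/RC_wle H]; [|apply/q_wle]; rewrite RrE // => /RC_wle.
  by apply/q_paut; rewrite !RrE.
(* [glue] identifies only the points at exponent 0; the others are reached along the orbit, through
   [window_orbit] on both sides. *)
move=> a; have [[y k] <-] := h_onto a.
have [B1 B2] := window_orbit zN h_paut emb_f zB RB_paut false y k.
have [C1 C2] := window_orbit zN h_paut emb_g zC RC_paut false y k.
have [BC CB] := glue false y.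
apply: wle_anti; apply/q_wle; rewrite subrr.
  have H := ztrans zR (iffRL (RlE _ _ _ _) B1) BC erefl.
  by apply: (ztrans zR H (iffRL (RrE _ _ _ _) C2)); lia.
have H := ztrans zR (iffRL (RrE _ _ _ _) C1) CB erefl.
by apply: (ztrans zR H (iffRL (RlE _ _ _ _) B2)); lia.
Qed.
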